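(* For every integer $N\geq 3$, let $$\Theta_3(N) = \frac{7}{3}\,2^{2N-6}\prod_{i=1}^{3}\frac{2^{N-3+i}-1}{2^i-1}\prod_{i=1}^{3}\left(2^{N+1-i}+1\right).$$ Then $\Theta_3(N)$ is the number of those $\mathrm{PG}(3,2)$s of $\mathrm{PG}(2N-1,2)$ that contain exactly three totally isotropic planes $\mathrm{PG}(2,2)$, and the number $D_q(N)$ of quadratic doilies in $\mathcal{W}(2N-1,2)$ is $$D_q(N) = \frac{48}{15}\,4^{N-3}\,\Theta_3(N).$$
   Context: $\mathrm{PG}(d,2)$ is the projective space of $\mathbb{F}_2^{d+1}$; its points are the nonzero vectors and its lines the triples $\{a,b,a+b\}$. $\mathcal{W}(2N-1,2)$ is the symplectic polar space whose points are all points of $\mathrm{PG}(2N-1,2)$ (nonzero vectors of $\mathbb{F}_2^{2N}$) and whose subspaces are those totally isotropic for the symplectic form $\sigma(x,y)=\sum_{j=1}^N (x_j y_{N+j}+x_{N+j}y_j)$. Its lines are the totally isotropic lines, i.e. the triples $\{a,b,a+b\}$ with $a\neq b$ nonzero and $\sigma(a,b)=0$. The doily is the unique generalized quadrangle $\mathrm{GQ}(2,2)$ (15 points, 15 lines, 3 points per line, 3 lines per point, and for each point $p$ not on a line $L$ there is a unique point of $L$ collinear with $p$). A doily in $\mathcal{W}(2N-1,2)$ (an $N$-qubit doily) is a set of 15 points of $\mathcal{W}(2N-1,2)$ together with 15 lines of $\mathcal{W}(2N-1,2)$ on these points, forming an incidence structure isomorphic to the doily, such that two distinct points $a,b$ of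 it satisfy $\sigma(a,b)=0$ if and only if they lie on a common line of it. A doily in $\mathcal{W}(2N-1,2)$ is called quadratic if its 15 points span a $\mathrm{PG}(4,2)$ (i.e. a 5-dimensional vector subspace of $\mathbb{F}_2^{2N}$). *)

(* Defs.v *)
From HB Require Import structures.
From mathcomp Require Import all_boot all_order all_algebra all_field.

Set Implicit Arguments.
Unset Strict Implicit.
Unset Printing Implicit Defensive.

Import GRing.Theory Num.Theory.
Local Open Scope ring_scope.

(* The library provides no finType structure on subspaces over a finite       *)
(* field; VectorInternalTheory gives access to the underlying subType.        *)
Section VspaceFinite.
Import vector.VectorInternalTheory.
Variables (F : finFieldType) (V : vectType F).
HB.instance Definition _ := [Finite of {vspace V} by <:].
End VspaceFinite.

(* A PG(k, 2) of PG(2N - 1, 2) is represented by the (k + 1)-dimensional      *)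
(* subspace of F_2^2N whose nonzero vectors are its points. The coordinates   *)
(* x_j and x_(N + j), 1 <= j <= N, are x 0 (lshift N j) and x 0 (rshift N j)  *)
(* for j : 'I_N.                                                              *)
Notation F2vec N := 'rV['F_2]_(N + N).

Definition symp (N : nat) (x y : F2vec N) : 'F_2 :=
  \sum_(j < N) (x 0 (lshift N j) * y 0 (rshift N j)
                + x 0 (rshift N j) * y 0 (lshift N j)).

Definition totally_isotropic (N : nat) (U : {vspace F2vec N}) : bool :=
  [forall x in U, forall y in U, symp x y == 0].

Definition isotropic_planes_in (N : nat) (U : {vspace F2vec N}) :
    {set {vspace F2vec N}} :=
  [set W : {vspace F2vec N} |
     [&& (W <= U)%VS, \dim W == 3%N & totally_isotropic W]].

Definition solids_with_3_isotropic_planes (N : nat) : {set {vspace F2vec N}} :=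
  [set U : {vspace F2vec N} |
     (\dim U == 4%N) && (#|isotropic_planes_in U| == 3%N)].

Definition polar_points (N : nat) : {set F2vec N} := [set a | a != 0].

Definition polar_lines (N : nat) : {set {set F2vec N}} :=
  [set l | [exists a, exists b,
     [&& a != 0, b != 0, a != b, symp a b == 0 & l == [set a; b; a + b]]]].

Definition on_common_line (T : finType) (L : {set {set T}}) (a b : T) : bool :=
  [exists l in L, (a \in l) && (b \in l)].

(* Lines are sets of points and incidence is membership. Two distinct lines   *)
(* l, l' share at most one point: if they shared a != b, the third point of   *)
(* l' would be off l and collinear with both a and b, against the last axiom. *)
Definition GQ22 (T : finType) (P : {set T}) (L : {set {set T}}) : bool :=
  [&& #|P| == 15%N, #|L| == 15%N,
      [forall l in L, (l \subset P) && (#|l| == 3%N)],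
      [forall p in P, #|[set l in L | p \in l]| == 3%N] &
      [forall l in L, forall p in P :\: l,
         #|[set q in l | on_common_line L p q]| == 1%N]].

(* The doily is known only up to isomorphism, as the unique GQ(2,2), so       *)
(* being isomorphic to it is being a GQ(2,2).                                 *)
Definition is_doily (N : nat) (P : {set F2vec N}) (L : {set {set F2vec N}}) :
    bool :=
  [&& P \subset polar_points N, L \subset polar_lines N, GQ22 P L &
      [forall a in P, forall b in P,
         (a != b) ==> ((symp a b == 0) == on_common_line L a b)]].

Definition quadratic_doilies (N : nat) :
    {set {set F2vec N} * {set {set F2vec N}}} :=
  [set D : {set F2vec N} * {set {set F2vec N}} |
     is_doily D.1 D.2 && (\dim <<enum D.1>>%VS == 5%N)].

(* The exponents are truncated natural numbers, exact for N >= 3.             *)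
Definition Theta3 (N : nat) : rat :=
  7 / 3 * 2 ^+ (2 * N - 6)%N
  * (\prod_(1 <= i < 4) ((2 ^+ (N - 3 + i)%N - 1) / (2 ^+ i - 1)))
  * (\prod_(1 <= i < 4) (2 ^+ (N + 1 - i)%N + 1)).

(* Main.v *)
Require Import Defs.
From HB Require Import structures.
From mathcomp Require Import all_boot all_order all_algebra all_field.
From mathcomp Require Import zify ring.

Set Implicit Arguments.
Unset Strict Implicit.
Unset Printing Implicit Defensive.

Import GRing.Theory Num.Theory.
Local Open Scope ring_scope.

(* Both counts are double countings of frames, i.e. ordered free families with
   a prescribed Gram matrix. The number of frames in F_2^2N is a product of
   factors 2^(2N - k) - s: extending a frame of k vectors amounts to solving k
   independent linear equations outside the span of the frame, which contains s
   solutions. The number of frames inside a fixed configuration does not depend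
   on N: it is computed in coordinates relative to one of them.

   A solid contains exactly three isotropic planes iff the form has rank 2 on
   it, iff it has a basis b, a, r2, r1 with r1, r2 in the radical and
   symp a b = 1. A doily contains opposite points p, q, whose three common
   neighbours c1, c2, c3 are pairwise opposite; p, q, c1, c2, c3 generate the
   doily under third points of lines, and the doily is quadratic iff these five
   vectors are free. *)

(** * Coordinates over F_2 as lists of booleans *)

Fixpoint bits (k : nat) : seq bitseq :=
  if k is k'.+1 then [seq b :: m | b <- [:: false; true], m <- bits k']
  else [:: [::]].

Fixpoint xorv (m n : bitseq) : bitseq :=
  match m, n with
  | b :: m', c :: n' => (b (+) c) :: xorv m' n'
  | _, _ => [::]
  end.

(** Over F_2 a linear combination is the sum of a selected sublist. The operation is a parameter so
    that the same recursion serves vectors ([ev]) and bit lists ([xor_sum]), the latter evaluating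
    under [vm_compute]. *)
Fixpoint subset_sum (T : Type) (op : T -> T -> T) (e : T)
    (t : seq T) (m : bitseq) : T :=
  match t, m with
  | z :: t', b :: m' =>
      if b then op z (subset_sum op e t' m') else subset_sum op e t' m'
  | _, _ => e
  end.

Definition xor_sum (k : nat) := subset_sum xorv (nseq k false).

Fixpoint unit_bits (k : nat) : seq bitseq :=
  if k is k'.+1 then (true :: nseq k' false) :: map (cons false) (unit_bits k')
  else [::].

Fixpoint dot (r m : bitseq) : bool :=
  match r, m with
  | b :: r', c :: m' => (b && c) (+) dot r' m'
  | _, _ => false
  end.

(* An alternating Gram matrix is stored by the rows of its strictly upper
   triangle. *)
Fixpoint alt_form (G : seq bitseq) (x y : bitseq) : bool :=
  match G, x, y with
  | r :: G', b :: x', c :: y' =>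
      (b && dot r y') (+) (c && dot r x') (+) alt_form G' x' y'
  | _, _, _ => false
  end.

Lemma mem_bits k m : (m \in bits k) = (size m == k).
Proof.
elim: k m => [|k IHk] m; first by rewrite inE; case: m.
apply/allpairsP/eqP => [[[b n] /= [_ nk ->]]|].
  by move: nk; rewrite IHk => /eqP /= ->.
case: m => // b m [mk]; exists (b, m); split=> //; last by rewrite IHk mk.
by rewrite !inE; case: b.
Qed.

Lemma bits_uniq k : uniq (bits k).
Proof.
elim: k => // k IHk; apply: allpairs_uniq => // -[b m] [c n] _ _ /=.
by case=> -> ->.
Qed.

Lemma size_xorv m n : size m = size n -> size (xorv m n) = size m.
Proof. by elim: m n => [|b m IHm] [|c n] //= [/IHm->]. Qed.

Definition ev (V : nmodType) : seq V -> bitseq -> V := subset_sum +%R 0.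

Arguments xor_sum : simpl never.
Arguments ev : simpl never.

Lemma xor_sum_cons k z t b m :
  xor_sum k (z :: t) (b :: m) =
    if b then xorv z (xor_sum k t m) else xor_sum k t m.
Proof. by []. Qed.

Lemma size_xor_sum k t m :
  {in t, forall z : bitseq, size z = k} -> size (xor_sum k t m) = k.
Proof.
elim: t m => [|z t IHt] [|b m] tk; rewrite ?size_nseq //.
have tk' : {in t, forall z : bitseq, size z = k}.
  by move=> y yt; apply: tk; rewrite inE yt orbT.
have zk : size z = k by apply: tk; rewrite mem_head.
have mk : size (xor_sum k t m) = k by apply: IHt.
by rewrite xor_sum_cons; case: b; rewrite ?size_xorv ?zk ?mk.
Qed.

Lemma ev_cons (V : nmodType) (z : V) t b m :
  ev (z :: t) (b :: m) = if b then z + ev t m else ev t m.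
Proof. by []. Qed.

Lemma ev_nseq0 (V : nmodType) (t : seq V) k : ev t (nseq k false) = 0.
Proof. by elim: t k => [|z t IHt] [|k] //=; rewrite ev_cons IHt. Qed.

Lemma map_ev_unit_bits (V : nmodType) (t : seq V) :
  map (ev t) (unit_bits (size t)) = t.
Proof.
elim: t => //= z t IHt; rewrite ev_cons ev_nseq0 addr0; congr cons.
by rewrite -map_comp -[RHS]IHt; apply: eq_map => m.
Qed.

Lemma addvv2 n (x : 'rV['F_2]_n) : x + x = 0.
Proof.
rewrite -mulr2n -scaler_nat (_ : 2%:R = 0 :> 'F_2) ?scale0r //.
exact/val_inj.
Qed.

Lemma F2_boolE (c : 'F_2) : c = (c != 0)%:R.
Proof. by case: c => [[|[|m]] mP] //; apply/val_inj. Qed.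

Lemma F2_scaleE n (c : 'F_2) (x : 'rV['F_2]_n) :
  c *: x = if c != 0 then x else 0.
Proof. by rewrite {1}[c]F2_boolE; case: (c != 0); rewrite ?scale1r ?scale0r. Qed.

Lemma ev_xorv n (t : seq 'rV['F_2]_n) x y :
  size x = size t -> size y = size t -> ev t (xorv x y) = ev t x + ev t y.
Proof.
elim: t x y => [|z t IHt] [|b x] [|c y] //=; first by rewrite addr0.
move=> [xt] [yt]; rewrite !ev_cons IHt //.
case: b; case: c => //=; first by rewrite addrACA addvv2 add0r.
  by rewrite addrA.
by rewrite addrCA.
Qed.

Lemma ev_xor_sum n (t : seq 'rV['F_2]_n) k s m : k = size t ->
  {in s, forall z : bitseq, size z = k} ->
  ev t (xor_sum k s m) = ev (map (ev t) s) m.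
Proof.
move=> kt; elim: s m => [|z s IHs] [|b m] sk; rewrite ?ev_nseq0 //=.
have sk' : {in s, forall z : bitseq, size z = k}.
  by move=> y ys; apply: sk; rewrite inE ys orbT.
have zk : size z = k by apply: sk; rewrite mem_head.
rewrite xor_sum_cons ev_cons -IHs //; case: b => //.
by rewrite ev_xorv -?kt ?size_xor_sum.
Qed.

Lemma mem_span_ev n (t : seq 'rV['F_2]_n) x :
  (x \in <<t>>%VS) = (x \in map (ev t) (bits (size t))).
Proof.
elim: t x => [|z t IHt] x; first by rewrite span_nil memv0 inE.
rewrite span_cons; apply/memv_addP/mapP => [[_ /vlineP[c ->] [y yt ->]]|].
  move: yt; rewrite IHt => /mapP[m mt ->].
  exists ((c != 0) :: m); first by move: mt; rewrite !mem_bits /= eqSS.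
  by rewrite ev_cons F2_scaleE; case: (c != 0); rewrite ?add0r.
case=> [[|b m]]; rewrite mem_bits //= eqSS => mt ->.
exists (if b then z else 0); first by case: b; rewrite ?memv_line ?mem0v.
exists (ev t m); first by rewrite IHt map_f // mem_bits.
by rewrite ev_cons; case: b; rewrite ?add0r.
Qed.

Lemma ev_inj n (t : seq 'rV['F_2]_n) : free t ->
  {in bits (size t) &, injective (ev t)}.
Proof.
elim: t => [|z t IHt] tfree x y; rewrite !mem_bits.
  by move=> /eqP/size0nil-> /eqP/size0nil->.
move: tfree; rewrite free_cons => /andP[ztN /IHt tinj].
case: x y => [|b x] [|c y] //=; rewrite !eqSS !ev_cons => xt yt.
have txy : ev t x = ev t y -> x = y by apply: tinj; rewrite mem_bits.
have tP m : size m == size t -> ev t m \in <<t>>%VS.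
  by move=> mt; rewrite mem_span_ev map_f // mem_bits.
(* If the leading bits differ, [z] is a difference of two elements of the span of [t], against
   freeness. *)
case: b; case: c; [by move/addrI/txy-> | move=> e | move=> e | by move/txy->];
  case/negP: ztN.
  by rewrite -(addrK (ev t x) z) e memvB ?tP.
by rewrite -(addrK (ev t y) z) -e memvB ?tP.
Qed.

(** * The symplectic form and Gram matrices in coordinates *)

Definition sympb (N : nat) (x y : F2vec N) : bool := symp x y != 0.

Lemma F2_addb (c d : 'F_2) : (c + d != 0) = (c != 0) (+) (d != 0).
Proof.
by case: c => [[|[|c]] cP] //; case: d => [[|[|d]] dP].
Qed.

Lemma sympC N (x y : F2vec N) : symp x y = symp y x.
Proof.
by apply: eq_bigr => i _; rewrite addrC; congr (_ + _); rewrite mulrC.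
Qed.

Lemma symp_additive N (x y z : F2vec N) : symp (x + y) z = symp x z + symp y z.
Proof.
rewrite -big_split; apply: eq_bigr => i _ /=.
by rewrite !mxE !mulrDl addrACA.
Qed.

Lemma sympb0l N (x : F2vec N) : sympb 0 x = false.
Proof.
apply/negbF/eqP/big1 => i _; by rewrite !mxE !mul0r addr0.
Qed.

Lemma sympbC N (x y : F2vec N) : sympb x y = sympb y x.
Proof. by rewrite /sympb sympC. Qed.

Lemma sympbDl N (x y z : F2vec N) : sympb (x + y) z = sympb x z (+) sympb y z.
Proof. by rewrite /sympb symp_additive F2_addb. Qed.

Lemma sympbDr N (x y z : F2vec N) : sympb z (x + y) = sympb z x (+) sympb z y.
Proof. by rewrite ![sympb z _]sympbC sympbDl. Qed.

Lemma sympbxx N (x : F2vec N) : sympb x x = false.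
Proof.
apply/negbF/eqP/big1 => i _; rewrite [in X in _ + X]mulrC.
by rewrite -mulr2n -mulr_natl (_ : 2%:R = 0 :> 'F_2) ?mul0r //; apply/val_inj.
Qed.

Fixpoint gram (N : nat) (t : seq (F2vec N)) : seq bitseq :=
  if t is z :: t' then map (sympb z) t' :: gram t' else [::].

Lemma size_gram N (t : seq (F2vec N)) : size (gram t) = size t.
Proof. by elim: t => //= z t ->. Qed.

Lemma sympb_ev_r N (z : F2vec N) t y : size y = size t ->
  sympb z (ev t y) = dot (map (sympb z) t) y.
Proof.
elim: t y => [|u t IHt] [|b y] //=; first by rewrite sympbC sympb0l.
by case=> yt; rewrite ev_cons -IHt //; case: b; rewrite ?andbT ?andbF ?sympbDr.
Qed.

Lemma sympb_ev N (t : seq (F2vec N)) x y : size x = size t -> size y = size t ->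
  sympb (ev t x) (ev t y) = alt_form (gram t) x y.
Proof.
elim: t x y => [|z t IHt] [|b x] [|c y] //=; first by rewrite sympb0l.
move=> [xt] [yt]; rewrite !ev_cons -IHt // -!sympb_ev_r //.
case: b; case: c; rewrite ?sympbDl ?sympbDr ?sympbxx //=.
- by rewrite [sympb (ev t x) z]sympbC addbA.
- by rewrite addbF.
- by rewrite [sympb (ev t x) z]sympbC.
Qed.

(** * Frames and their enumeration inside a fixed span *)

Definition frame (N : nat) (G : seq bitseq) (t : seq (F2vec N)) : bool :=
  free t && (gram t == G).

(* Lists the coordinates, all taken in S, of the frames with Gram matrix G in
   the span of a free family with Gram matrix G0. *)
Fixpoint frames_in (G0 : seq bitseq) (S : seq bitseq) (G : seq bitseq) :
    seq (seq bitseq) :=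
  if G is r :: G' then
    [seq z :: t | t <- frames_in G0 S G',
       z <- [seq z <- S | (map (alt_form G0 z) t == r)
         && (z \notin map (xor_sum (size G0) t) (bits (size t)))]]
  else [:: [::]].

Lemma frames_in_sub G0 S G t : t \in frames_in G0 S G ->
  (size t == size G) && all [in S] t.
Proof.
elim: G t => [|r G IHG] t /=; first by rewrite inE => /eqP->.
case/allpairsPdep=> s [z [/IHG/andP[/eqP<- sS]]].
by rewrite mem_filter => /andP[_ zS] -> /=; rewrite eqxx zS.
Qed.

Lemma frames_in_uniq G0 S G : uniq S -> uniq (frames_in G0 S G).
Proof.
move=> uS; elim: G => //= r G IHG; apply: allpairs_uniq_dep => //.
  by move=> t _; apply: filter_uniq.
by move=> [t z] [s y] _ _ /= [-> ->].
Qed.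

Lemma frame_cons N r G z (t : seq (F2vec N)) :
  frame (r :: G) (z :: t) =
    [&& frame G t, map (sympb z) t == r & z \notin <<t>>%VS].
Proof.
rewrite /frame free_cons /= eqseq_cons.
by case: (free t); case: (gram t == G); case: (_ \in _); case: (_ == r).
Qed.

Lemma size_frame N G (t : seq (F2vec N)) : frame G t -> size t = size G.
Proof. by case/andP=> _ /eqP<-; rewrite size_gram. Qed.

(** Since [t0] is free, [ev t0] is injective and additive and carries [alt_form (gram t0)] to the
    symplectic form, so both the Gram condition and being outside a span can be tested on
    coordinates. *)
Lemma mem_frames_in N (t0 t : seq (F2vec N)) S G :
    free t0 -> {subset S <= bits (size t0)} ->
  (t \in map (map (ev t0)) (frames_in (gram t0) S G)) =
    frame G t && all [in map (ev t0) S] t.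
Proof.
move=> t0free Sbits; have t0inj := ev_inj t0free.
have sizeS z : z \in S -> size z = size t0.
  by move/Sbits; rewrite mem_bits => /eqP.
elim: G t => [|r G IHG] t.
  rewrite inE /frame; case: t => [|z t]; first by rewrite nil_free.
  by rewrite /= andbF.
(* The filter used by [frames_in] on a new vector is exactly the condition for extending the frame
   by it. *)
have step s z : s \in frames_in (gram t0) S G -> z \in S ->
    (map (alt_form (gram t0) z) s == r)
      && (z \notin map (xor_sum (size (gram t0)) s) (bits (size s)))
    = frame (r :: G) (map (ev t0) (z :: s)).
  move=> sG zS; have /andP[_ /allP sS] := frames_in_sub sG.
  have sF : frame G (map (ev t0) s).
    suff /andP[]: frame G (map (ev t0) s)
        && all [in map (ev t0) S] (map (ev t0) s) by [].
    by rewrite -IHG map_f.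
  have sk : {in s, forall y : bitseq, size y = size t0}.
    by move=> y /sS/sizeS.
  rewrite map_cons frame_cons sF /=; congr (_ && ~~ _).
    congr (_ == r); rewrite -map_comp; apply/eq_in_map => y /sk yk /=.
    by rewrite sympb_ev // sizeS.
  rewrite mem_span_ev size_map size_gram.
  apply/mapP/mapP=> -[m mb e]; exists m => //.
    by rewrite e ev_xor_sum.
  apply: t0inj; rewrite ?mem_bits ?size_xor_sum ?sizeS //.
  by rewrite e ev_xor_sum.
apply/mapP/andP=> [[u /allpairsPdep[s [z [sG]]]]|[]].
  rewrite mem_filter => /andP[szG zS] -> ->.
  rewrite -step // szG; split=> //; apply/allP=> y.
  have /andP[_ /allP sS] := frames_in_sub sG.
  move/mapP=> [m ms ->]; rewrite map_f //.
  by move: ms; rewrite inE => /predU1P[->|/sS].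
case: t => [|y s ysG /= /andP[/mapP[z zS yE]] sS]; first by rewrite /frame andbF.
have : s \in map (map (ev t0)) (frames_in (gram t0) S G).
  by rewrite IHG sS andbT; move: ysG; rewrite frame_cons => /and3P[].
case/mapP=> u uG sE; exists (z :: u); last by rewrite /= yE sE.
apply/allpairsPdep; exists u, z; split=> //.
by rewrite mem_filter zS andbT step // map_cons -yE -sE.
Qed.

Lemma card_tuple_seq (T : finType) k (A : {set k.-tuple T}) (s : seq (seq T)) :
  uniq s -> (forall t : seq T, t \in s -> size t == k) ->
  (forall t : k.-tuple T, (t \in A) = (tval t \in s)) -> #|A| = size s.
Proof.
move=> us sk As; rewrite cardE -(size_map val).
apply: perm_size; apply: uniq_perm => //.
  by rewrite map_inj_uniq ?enum_uniq //; apply: val_inj.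
move=> t; apply/mapP/idP=> [[u]|ts]; first by rewrite mem_enum As => us' ->.
by exists (Tuple (sk _ ts)) => //; rewrite mem_enum As.
Qed.

Lemma card_frames_in N (t0 : seq (F2vec N)) S G :
    free t0 -> uniq S -> {subset S <= bits (size t0)} ->
  #|[set t : (size G).-tuple (F2vec N) |
      frame G t && all [in map (ev t0) S] t]|
    = size (frames_in (gram t0) S G).
Proof.
move=> t0free uS Sbits; rewrite -(size_map (map (ev t0))).
have t0inj := ev_inj t0free.
apply: card_tuple_seq => [|t|t]; last by rewrite mem_frames_in // inE.
  rewrite map_inj_in_uniq ?frames_in_uniq // => s u.
  move=> /frames_in_sub/andP[/eqP sk /allP sS] /frames_in_sub/andP[/eqP uk /allP uu].
  have: size s = size u by rewrite sk uk.
  elim: s u {sk uk} sS uu => [|x s IHs] [|y u] //= sS uS' [su] [xy e].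
  congr (_ :: _).
    by apply: t0inj => //; apply: Sbits; [apply: sS | apply: uS']; rewrite mem_head.
  by apply: IHs => // z zs; [apply: sS | apply: uS']; rewrite inE zs orbT.
by rewrite mem_frames_in // => /andP[/size_frame->].
Qed.

(** * Double counting and the number of all frames *)

Lemma card_uniform_fibers (T T' : finType) (f : T -> T') (A : {set T})
    (B : {set T'}) m :
  {in A, forall x, f x \in B} ->
  {in B, forall y, #|[set x in A | f x == y]| = m} -> #|A| = (#|B| * m)%N.
Proof.
move=> fAB fib; rewrite -sum1_card (partition_big f (fun y => y \in B)) //=.
rewrite -sum_nat_const; apply: eq_bigr => y /fib<-.
by rewrite -sum1_card; apply: eq_bigl => x; rewrite inE.
Qed.

Definition symp_mx N : 'M['F_2]_(N + N) := block_mx 0 1%:M 1%:M 0.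

Lemma symp_mx_invol N : symp_mx N *m symp_mx N = 1%:M.
Proof.
rewrite mulmx_block !mulmx0 !mul0mx !mulmx1 !addr0 !add0r.
by rewrite [RHS]scalar_mx_block.
Qed.

Lemma tr_symp_mx N : (symp_mx N)^T = symp_mx N.
Proof. by rewrite tr_block_mx !trmx0 !trmx1. Qed.

Lemma sympE N (x y : F2vec N) : symp x y = (x *m symp_mx N *m y^T) 0 0.
Proof.
rewrite -{2}[x]hsubmxK mul_row_block !mulmx0 !mulmx1 addr0 add0r.
rewrite mxE big_split_ord /= /symp big_split addrC /=; congr (_ + _).
  by apply: eq_bigr => i _; rewrite row_mxEr !mxE.
by apply: eq_bigr => i _; rewrite row_mxEl !mxE.
Qed.

(** The form is nondegenerate, so free vectors give independent linear equations; each solution set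
    is then a coset of one kernel. *)
Lemma card_symp_system N (t : seq (F2vec N)) (r : bitseq) :
  free t -> size r = size t ->
  #|[set z : F2vec N | map (sympb z) t == r]| = (2 ^ (N + N - size t))%N.
Proof.
move=> tfree rt; set k := size t.
pose A : 'M['F_2]_(k, N + N) := \matrix_(i < k) t`_i.
pose D := symp_mx N *m A^T.
have DE (z : F2vec N) i : (z *m D) 0 i = symp z t`_i.
  rewrite sympE mulmxA !mxE; apply: eq_bigr => j _; congr (_ * _).
  by rewrite !mxE.
(* The matrix of the form is its own inverse, so a relation between the columns of [D] would be a
   relation between the vectors of [t]. *)
have Dfull : row_full D.
  suff: row_free D^T by rewrite /row_free /row_full mxrank_tr.
  apply: inj_row_free => v.
  rewrite trmx_mul tr_symp_mx trmxK => /(congr1 (mulmx^~ (symp_mx N))).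
  rewrite -!mulmxA symp_mx_invol mulmx1 mul0mx => vA.
  apply/rowP=> i; rewrite [RHS]mxE.
  have /freeP := (tfree : free (in_tuple t)); apply.
  rewrite -[RHS]vA mulmx_sum_row; apply: eq_bigr => j _.
  by congr (_ *: _); apply/rowP=> l; rewrite !mxE.
pose fib c := [set z : F2vec N | z *m D == c].
have fibE c : #|fib c| = #|fib 0|.
  (* A particular solution; translation by it maps the kernel onto the fibre over [c]. *)
  have z0 : c *m pinvmx D *m D = c by rewrite mulmxKpV ?submx_full.
  rewrite -[RHS](card_imset _ (addIr (c *m pinvmx D))); apply: eq_card => z.
  apply/idP/imsetP => [|[y]]; rewrite !inE.
    move/eqP=> zD; exists (z - c *m pinvmx D); last by rewrite subrK.
    by rewrite inE mulmxBl zD z0 subrr.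
  by move=> /eqP yD ->; rewrite mulmxDl yD z0 add0r.
have kle : (k <= N + N)%N by rewrite -(eqP Dfull) rank_leq_row.
have fib0 : #|fib 0| = (2 ^ (N + N - k))%N.
  apply/eqP; rewrite -(eqn_pmul2l (expn_gt0 2 k)) -expnD subnKC //.
  (* The 2 ^ k fibres have equal size and partition the 2 ^ (N + N) vectors. *)
  have := @card_uniform_fibers _ _ (mulmx^~ D) [set: F2vec N] [set: 'rV_k] #|fib 0|.
  rewrite !cardsT !card_mx !mul1n card_Fp // => ->//.
  by move=> c _; rewrite -(fibE c); apply: eq_card => z; rewrite !inE.
rewrite -fib0 -(fibE (\row_i (nth false r i)%:R)); apply: eq_card => z.
rewrite !inE; apply/eqP/eqP => [<-|/rowP zr].
  apply/rowP=> i; rewrite DE mxE (nth_map 0) //; exact: F2_boolE.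
apply: (@eq_from_nth _ false); rewrite size_map // => i ik.
rewrite (nth_map 0) //; have := zr (Ordinal ik); rewrite DE mxE /sympb /= => ->.
by case: (nth _ _ _).
Qed.

Fixpoint triangular (G : seq bitseq) : bool :=
  if G is r :: G' then (size r == size G') && triangular G' else true.

Lemma triangular_gram N (t : seq (F2vec N)) : triangular (gram t).
Proof. by elim: t => //= z t ->; rewrite size_map size_gram eqxx. Qed.

(** For a frame with Gram matrix [G], these are the coordinates of the vectors of its own span whose
    form values on it are [r]. They solve the system without extending the frame, and depend on [G]
    only. *)
Definition span_solutions (G : seq bitseq) (r : bitseq) : seq bitseq :=
  [seq m <- bits (size G) | map (alt_form G m) (unit_bits (size G)) == r].

Fixpoint nb_frames (N : nat) (G : seq bitseq) : nat :=
  if G is r :: G' then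
    nb_frames N G'
      * (2 ^ (N + N - size G') - size (span_solutions G' r))
  else 1.

Lemma size_unit_bits k m : m \in unit_bits k -> size m = k.
Proof.
elim: k m => // k IHk m; rewrite inE => /predU1P[->|/mapP[u /IHk uk ->]] /=.
  by rewrite size_nseq.
by rewrite uk.
Qed.

Lemma sympb_ev_family N (t : seq (F2vec N)) m : size m = size t ->
  map (sympb (ev t m)) t = map (alt_form (gram t) m) (unit_bits (size t)).
Proof.
move=> mt; rewrite -{2}(map_ev_unit_bits t) -map_comp; apply/eq_in_map => u.
by move=> /size_unit_bits us /=; rewrite sympb_ev.
Qed.

(** The extensions are the solutions of the linear system given by [r], minus those lying in the
    span of [t]. *)
Lemma card_frame_extensions N r G (t : seq (F2vec N)) :
  size r = size G -> frame G t ->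
  #|[set z | frame (r :: G) (z :: t)]|
    = (2 ^ (N + N - size G) - size (span_solutions G r))%N.
Proof.
move=> rG tG; have tk := size_frame tG; have /andP[tfree /eqP tgram] := tG.
rewrite -tk -(card_symp_system tfree (r := r)) ?tk //.
set Z := [set z | map _ _ == r].
have -> : [set z | frame (r :: G) (z :: t)] = Z :\: [set z | z \in <<t>>%VS].
  by apply/setP=> z; rewrite /Z !inE frame_cons tG /= andbC.
rewrite cardsD; congr (_ - _)%N.
have ss : {subset span_solutions G r <= bits (size t)}.
  by move=> m; rewrite mem_filter tk => /andP[].
have ui : uniq (map (ev t) (span_solutions G r)).
  rewrite map_inj_in_uniq ?filter_uniq ?bits_uniq // => m n /ss mt /ss nt.
  exact: ev_inj.
rewrite -(size_map (ev t)) -(card_uniqP ui); apply: eq_card => z.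
rewrite /Z !inE mem_span_ev.
have grE m : m \in bits (size t) ->
    map (sympb (ev t m)) t = map (alt_form G m) (unit_bits (size t)).
  by rewrite mem_bits -tgram => /eqP; apply: sympb_ev_family.
apply/andP/mapP=> [[zr /mapP[m mt zE]]|[m]].
  by exists m => //; rewrite mem_filter -tk mt -grE // -zE zr.
rewrite mem_filter -tk => /andP[mr mt] ->.
by rewrite grE // map_f // mr.
Qed.

(** Frames grow at the head: the fibres of [behead_tuple] are the extensions of a shorter frame,
    whose number depends on its Gram matrix only. *)
Lemma card_frames N G : triangular G ->
  #|[set t : (size G).-tuple (F2vec N) | frame G t]| = nb_frames N G.
Proof.
elim: G => [|r G IHG] /=.
  move=> _; rewrite -[RHS](cards1 ([tuple] : 0.-tuple (F2vec N))).
  by apply: eq_card => t; rewrite !inE tuple0 /frame nil_free /= !eqxx.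
case/andP=> /eqP rG /IHG<-.
apply: (@card_uniform_fibers _ _ (fun u => behead_tuple u)) => [u|t].
  by rewrite !inE; case/tupleP: u => z t; rewrite frame_cons => /and3P[].
rewrite inE => tG; rewrite -(card_frame_extensions rG tG).
have cinj : injective (fun z => cons_tuple z t) by move=> y z [].
rewrite -[RHS](card_imset _ cinj); apply: eq_card => u; rewrite !inE.
apply/andP/imsetP=> [[uG /eqP ut]|[z]].
  exists (thead u); last by rewrite -ut [LHS]tuple_eta; apply: val_inj.
  by rewrite inE -ut; case/tupleP: {ut} u uG.
by rewrite inE => zG ->; split=> //; apply/eqP/val_inj.
Qed.

(** * Solids with exactly three isotropic planes *)

Lemma span_eq_sub n (t : seq 'rV['F_2]_n) (U : {vspace 'rV['F_2]_n}) :
  free t -> size t = \dim U -> (<<t>>%VS == U) = all [in U] t.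
Proof.
move=> /eqP tfree tU; rewrite eqEdim tfree tU leqnn andbT.
by apply/span_subvP/allP.
Qed.

Lemma card_frames_spanning N G (w : seq (F2vec N)) :
  free w -> size w = size G ->
  #|[set t : (size G).-tuple (F2vec N) |
      frame G t && (<<t>>%VS == <<w>>%VS)]|
    = size (frames_in (gram w) (bits (size G)) G).
Proof.
move=> wfree wG; rewrite -card_frames_in ?bits_uniq ?wG //.
apply: eq_card => t; rewrite !inE; apply: andb_id2l => tG.
have /andP[tfree _] := tG.
rewrite span_eq_sub ?(eqP wfree) ?(size_frame tG) //.
by apply: eq_all => x; rewrite -wG -mem_span_ev.
Qed.

Fixpoint zero_gram (k : nat) : seq bitseq :=
  if k is k'.+1 then nseq k' false :: zero_gram k' else [::].

Lemma dot_nseq0 k m : dot (nseq k false) m = false.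
Proof. by elim: k m => [|k IHk] [|b m] //=. Qed.

Lemma alt_form_zero k x y : alt_form (zero_gram k) x y = false.
Proof.
by elim: k x y => // k IHk [|b x] [|c y] //=; rewrite !dot_nseq0 !andbF IHk.
Qed.

Lemma totally_isotropic_span N (w : seq (F2vec N)) :
  totally_isotropic <<w>>%VS = (gram w == zero_gram (size w)).
Proof.
apply/idP/eqP => [wiso|wG].
  have {wiso}: {in w &, forall x y, sympb x y = false}.
    move=> x y xw yw; apply/negbF.
    by move/forall_inP/(_ x (memv_span xw))/forall_inP: wiso; apply; apply: memv_span.
  elim: w => //= z w IHw iso; congr (_ :: _); last first.
    by apply: IHw => x y xw yw; apply: iso; rewrite inE ?xw ?yw orbT.
  apply: (@eq_from_nth _ false); rewrite size_map ?size_nseq // => i iw.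
  by rewrite (nth_map 0) // nth_nseq iw iso ?mem_head // inE mem_nth ?orbT.
apply/forall_inP=> x; rewrite mem_span_ev => /mapP[m mb ->].
apply/forall_inP=> y; rewrite mem_span_ev => /mapP[n nb ->].
move: mb nb; rewrite !mem_bits => /eqP mb /eqP nb.
by apply: negbFE; rewrite -/(sympb _ _) sympb_ev // wG alt_form_zero.
Qed.

Fixpoint triangular_grams (k : nat) : seq (seq bitseq) :=
  if k is k'.+1 then [seq r :: G | r <- bits k', G <- triangular_grams k']
  else [:: [::]].

Lemma mem_triangular_grams G : triangular G -> G \in triangular_grams (size G).
Proof.
elim: G => //= r G IHG /andP[rG /IHG GG].
by apply/allpairsP; exists (r, G); rewrite /= mem_bits.
Qed.

Lemma vspace_free_span n (U : {vspace 'rV['F_2]_n}) :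
  {w | [/\ free w, size w = \dim U & <<w>>%VS = U]}.
Proof.
exists (vbasis U); split; last exact: (span_basis (vbasisP U)).
  exact: (basis_free (vbasisP U)).
exact: size_tuple.
Qed.

(* A plane has 7 * 6 * 4 = 168 ordered bases. *)
Lemma card_isotropic_planes_in N (w : seq (F2vec N)) : free w ->
  (#|isotropic_planes_in <<w>>%VS| * 168)%N
    = size (frames_in (gram w) (bits (size w)) (zero_gram 3)).
Proof.
move=> wfree; rewrite -card_frames_in ?bits_uniq //; symmetry.
apply: (@card_uniform_fibers _ _
  (fun t : (size (zero_gram 3)).-tuple (F2vec N) => <<t>>%VS) _
  (isotropic_planes_in <<w>>%VS)) => [t|W].
  rewrite !inE => /andP[/andP[tfree /eqP tG] tw]; apply/and3P; split.
  - by apply/span_subvP=> x /(allP tw); rewrite /= -mem_span_ev.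
  - by rewrite (eqP tfree) size_tuple.
  - by rewrite totally_isotropic_span tG size_tuple.
have [v [vfree _ <-]] := vspace_free_span W.
rewrite inE (eqP vfree) totally_isotropic_span => /and3P[vw /eqP v3].
rewrite v3 => /eqP vG.
have vcard := card_frames_spanning (G := zero_gram 3) vfree v3.
rewrite vG in vcard.
(* In coordinates of a basis of the plane its frames no longer depend on the plane, so their number
   is computed once. *)
transitivity (size (frames_in (zero_gram 3) (bits 3) (zero_gram 3))).
  rewrite -vcard.
  apply: eq_card => t; rewrite !inE.
  case tv: (_ == _); rewrite ?andbF ?andbT //.
  apply: andb_idr => tG; apply/allP=> x xt; rewrite /= -mem_span_ev.
  by apply: (subvP vw); rewrite -(eqP tv) memv_span.
by vm_compute.
Qed.

(** A hyperbolic pair b, a followed by r2, r1, which span the radical. *)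
Definition hyperbolic_gram : seq bitseq :=
  [:: [:: true; false; false]; [:: false; false]; [:: false]; [::]].

(* The 64 conceivable Gram matrices of a basis of a solid are checked. *)
Lemma isotropic_planes_model : all (fun G0 =>
    (size (frames_in G0 (bits 4) (zero_gram 3)) == (3 * 168)%N)
      == (frames_in G0 (bits 4) hyperbolic_gram != [::]))
  (triangular_grams 4).
Proof. by vm_compute. Qed.

(** Both sides are decided by [gram w]: one through the number of isotropic triples in the span, the
    other through whether [frames_in] is empty. [isotropic_planes_model] compares them for every
    possible [gram w]. *)
Lemma three_isotropic_planesP N (w : seq (F2vec N)) : free w -> size w = 4%N ->
  reflect
    (exists2 t : seq (F2vec N), frame hyperbolic_gram t & <<t>>%VS = <<w>>%VS)
    (#|isotropic_planes_in <<w>>%VS| == 3%N).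
Proof.
move=> wfree w4.
rewrite -(eqn_pmul2r (isT : 0 < 168)%N) card_isotropic_planes_in // w4.
have /(allP isotropic_planes_model)/eqP-> : gram w \in triangular_grams 4.
  by rewrite -w4 -(size_gram w) mem_triangular_grams ?triangular_gram.
have memE t : (t \in map (map (ev w)) (frames_in (gram w) (bits 4) hyperbolic_gram))
    = frame hyperbolic_gram t && (<<t>>%VS == <<w>>%VS).
  rewrite mem_frames_in ?w4 //; apply: andb_id2l => tG; have /andP[tfree _] := tG.
  rewrite span_eq_sub ?(eqP wfree) ?w4 ?(size_frame tG) //.
  by apply: eq_all => x; rewrite /= mem_span_ev w4.
apply: (iffP idP) => [|[t tG tw]].
  case: (frames_in _ _ _) memE => [//|s S] memE _; exists (map (ev w) s).
    by have /andP[] : _ && _ := etrans (esym (memE _)) (map_f _ (mem_head _ _)).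
  apply/eqP.
  by have /andP[] : _ && _ := etrans (esym (memE _)) (map_f _ (mem_head _ _)).
by move: (memE t); rewrite tG tw eqxx; case: (frames_in _ _ _).
Qed.

(* 576 = 3 * 2 * 12 * 8, choosing r1, r2, a, b in this order. *)
Lemma card_solids_with_3_isotropic_planes N :
  (#|solids_with_3_isotropic_planes N| * 576)%N = nb_frames N hyperbolic_gram.
Proof.
rewrite -card_frames //; symmetry.
apply: (@card_uniform_fibers _ _
  (fun t : (size hyperbolic_gram).-tuple (F2vec N) => <<t>>%VS) _
  (solids_with_3_isotropic_planes N)) => [t|U].
  rewrite !inE => tG; have /andP[tfree _] := tG.
  rewrite (eqP tfree) size_tuple eqxx.
  by apply/three_isotropic_planesP; rewrite ?size_tuple //; exists t.
have [w [wfree _ <-]] := vspace_free_span U.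
rewrite inE (eqP wfree) => /andP[/eqP w4 /(three_isotropic_planesP wfree w4)].
case=> t tG <-; have /andP[tfree /eqP tgram] := tG.
have tcard := card_frames_spanning (G := hyperbolic_gram) tfree (size_frame tG).
transitivity (size (frames_in hyperbolic_gram (bits 4) hyperbolic_gram)).
  by rewrite tgram in tcard; rewrite -tcard; apply: eq_card => s; rewrite !inE.
by vm_compute.
Qed.

(** * Quadrangles given by lists, and their injective images *)

(** A version of [GQ22] that evaluates by computation. The clause comparing lines by inclusion
    ensures that different lists remain different once turned into sets. *)
Definition seq_GQ22 (T : eqType) (pts : seq T) (lines : seq (seq T)) : bool :=
  let collinear x y := has (fun m => (x \in m) && (y \in m)) lines in
  [&& uniq pts && (size pts == 15%N), uniq lines && (size lines == 15%N),
      all (fun l => [&& all [in pts] l, uniq l & size l == 3%N]) lines,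
      all (fun l => all (fun m => all [in m] l ==> (l == m)) lines) lines,
      all (fun x => count (fun l => x \in l) lines == 3%N) pts &
      all (fun l => all (fun x =>
        (x \notin l) ==> (count (collinear x) l == 1%N)) pts) lines].

Definition image_lines (T : Type) (T' : finType) (f : T -> T')
    (lines : seq (seq T)) : {set {set T'}} :=
  [set:: [seq [set:: map f l] | l <- lines]].

Lemma card_set_seq (T : finType) (s : seq T) : uniq s -> #|[set:: s]| = size s.
Proof. by move=> us; rewrite cardsE; apply/card_uniqP. Qed.

Section SeqGQ.

Variables (T : eqType) (T' : finType) (f : T -> T').
Variables (pts : seq T) (lines : seq (seq T)).
Hypothesis f_inj : {in pts &, injective f}.
Hypothesis seqGQ : seq_GQ22 pts lines.

Lemma mem_image_line l x : l \in lines -> x \in pts ->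
  (f x \in [set:: map f l]) = (x \in l).
Proof.
case/and5P: seqGQ => _ _ /allP lpts _ _ /lpts/and3P[/allP lsub _ _] xpts.
rewrite inE; apply/mapP/idP=> [[y yl]|xl]; last by exists x.
by move/f_inj=> -> //; apply: lsub.
Qed.

Lemma image_line_inj : {in lines &, injective (fun l => [set:: map f l])}.
Proof.
move=> l m ll ml lm; case/and5P: seqGQ => _ _ /allP lpts /allP linc _.
have /and3P[/allP lsub _ _] := lpts _ ll.
have/allP/(_ _ ml)/implyP lmE := linc _ ll; apply/eqP/lmE/allP => x xl /=.
by rewrite -(mem_image_line ml) ?lsub // -lm mem_image_line ?lsub.
Qed.

Lemma on_common_line_image x y : x \in pts -> y \in pts ->
  on_common_line (image_lines f lines) (f x) (f y)
    = has (fun m => (x \in m) && (y \in m)) lines.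
Proof.
move=> xpts ypts; apply/exists_inP/hasP=> [[_ /[!inE] /mapP[l ll ->]]|[l ll xyl]].
  by rewrite !mem_image_line // => xyl; exists l.
exists [set:: map f l]; first by rewrite inE map_f.
by rewrite !mem_image_line.
Qed.

Lemma GQ22_image : GQ22 [set:: map f pts] (image_lines f lines).
Proof.
have /and5P[/andP[upts /eqP spts] /andP[ulines /eqP slines] /allP lpts _] := seqGQ.
case/andP=> /allP pt3 /allP GQ.
have im_line l : l \in lines ->
    [/\ {subset l <= pts}, uniq (map f l) & size (map f l) = 3%N].
  move/lpts=> /and3P[/allP ls ul /eqP sl]; split=> //; last by rewrite size_map.
  by rewrite map_inj_in_uniq // => x y /ls xp /ls yp; apply: f_inj.
have upt : uniq (map f pts) by rewrite map_inj_in_uniq.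
have uln : uniq [seq [set:: map f l] | l <- lines].
  by rewrite map_inj_in_uniq //; apply: image_line_inj.
apply/and5P; split.
- by rewrite card_set_seq ?size_map ?spts.
- by rewrite card_set_seq ?size_map ?slines.
- apply/forall_inP=> _ /[!inE] /mapP[l ll ->]; have [ls ul sl] := im_line _ ll.
  rewrite card_set_seq // sl eqxx andbT; apply/subsetP=> _ /[!inE] /mapP[x xl ->].
  by rewrite map_f ?ls.
- apply/forall_inP=> _ /[!inE] /mapP[x xpts ->].
  rewrite -(eqP (pt3 _ xpts)) -size_filter -(size_map (fun l => [set:: map f l])).
  rewrite -card_set_seq ?map_inj_in_uniq ?filter_uniq //; last first.
    move=> l m; rewrite !mem_filter => /andP[_ ll] /andP[_ ml].
    exact: image_line_inj.
  apply/eqP/eq_card=> L; rewrite !inE; apply/andP/mapP=> [[/mapP[l ll ->]]|[l]].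
    by rewrite mem_image_line // => xl; exists l => //; rewrite mem_filter xl.
  by rewrite mem_filter => /andP[xl ll] ->; rewrite map_f // mem_image_line.
apply/forall_inP=> _ /[!inE] /mapP[l ll ->]; have [ls ul sl] := im_line _ ll.
apply/forall_inP=> u /setDP[]; rewrite [u \in _]inE => /mapP[x xpts ->] {u}.
rewrite mem_image_line // => /negbTE xl.
have := allP (GQ _ ll) _ xpts; rewrite xl -size_filter => /eqP<-.
rewrite -(size_map f) -card_set_seq; last first.
  rewrite map_inj_in_uniq ?filter_uniq //; first by apply: map_uniq ul.
  move=> y z; rewrite !mem_filter => /andP[_ /ls yp] /andP[_ /ls zp].
  exact: f_inj.
apply/eqP/eq_card=> z; rewrite !inE; apply/andP/mapP=> [[/mapP[y yl ->]]|[y]].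
  by rewrite on_common_line_image // ?ls // => xy; exists y; rewrite // mem_filter xy.
rewrite mem_filter => /andP[xy yl] ->.
by rewrite map_f // on_common_line_image // ls.
Qed.

End SeqGQ.

(** * The model of the doily in coordinates *)

Fixpoint quad_form (G : seq bitseq) (m : bitseq) : bool :=
  match G, m with
  | r :: G', b :: m' => (b && dot r m') (+) quad_form G' m'
  | _, _ => false
  end.

(** The Gram matrix of c3, c2, c1, q, p: the c_i are pairwise opposite, p and q are opposite, and
    each c_i is orthogonal to p and q. *)
Definition doily_gram : seq bitseq :=
  [:: [:: true; true; false; false]; [:: true; false; false];
      [:: false; false]; [:: true]; [::]].

(* A quadratic doily is the parabolic quadric Q(4, 2) of the quadratic form
   that vanishes on a frame and polarizes to symp. *)
Definition doily_points : seq bitseq :=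
  [seq m <- bits 5 | (m != nseq 5 false) && ~~ quad_form doily_gram m].

(** The increasing order of indices makes each line appear once. *)
Definition doily_lines : seq (seq bitseq) :=
  let idx x := index x doily_points in
  [seq [:: x; y; xorv x y] | x <- doily_points,
     y <- [seq y <- doily_points |
             ~~ alt_form doily_gram x y && (idx x < idx y < idx (xorv x y))%N]].

Definition doily_of (N : nat) (t : seq (F2vec N)) :
    {set F2vec N} * {set {set F2vec N}} :=
  ([set:: map (ev t) doily_points], image_lines (ev t) doily_lines).

(** Form values on the five generators. They tell apart the images of points under [ev t] as soon as
    [gram t] is [doily_gram], so freeness of [t] can be derived afterwards. *)
Definition doily_profile (x : bitseq) : bitseq :=
  map (alt_form doily_gram x) (unit_bits 5).

Lemma doily_points_sub : {subset doily_points <= bits 5}.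
Proof. by move=> m; rewrite mem_filter => /andP[]. Qed.

Lemma size_doily_points : {in doily_points, forall x, size x = 5%N}.
Proof. by move=> x /doily_points_sub; rewrite mem_bits => /eqP. Qed.

(** Equal profiles mean that x + y is in the radical {0, c1 + c2 + c3}. The quadratic form is 1 on
    c1 + c2 + c3, so adding this vector to a point leaves the quadric. *)
Lemma doily_profile_inj : {in doily_points &, injective doily_profile}.
Proof.
have H : all (fun x => all (fun y =>
    (doily_profile x == doily_profile y) ==> (x == y)) doily_points) doily_points.
  by vm_compute.
by move=> x y xp yp /eqP xy; apply/eqP; exact: implyP (allP (allP H _ xp) _ yp) xy.
Qed.

Lemma doily_profile_neq0 : {in doily_points, forall x, true \in doily_profile x}.
Proof. by apply/allP; vm_compute. Qed.

Lemma seq_GQ22_doily : seq_GQ22 doily_points doily_lines.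
Proof. by vm_compute. Qed.

Lemma doily_collinear : {in doily_points &, forall x y, x != y ->
  has (fun l => (x \in l) && (y \in l)) doily_lines = ~~ alt_form doily_gram x y}.
Proof.
have H : all (fun x => all (fun y => (x != y) ==>
    (has (fun l => (x \in l) && (y \in l)) doily_lines
      == ~~ alt_form doily_gram x y)) doily_points) doily_points.
  by vm_compute.
by move=> x y xp yp xy; apply/eqP; exact: implyP (allP (allP H _ xp) _ yp) xy.
Qed.

Lemma doily_linesP l : l \in doily_lines -> exists x y,
  [/\ x \in doily_points, y \in doily_points, x != y,
      ~~ alt_form doily_gram x y & l = [:: x; y; xorv x y]].
Proof.
case/allpairsPdep=> x [y [xp]]; rewrite mem_filter.
case/andP=> /and3P[xy lxy _] yp ->; exists x, y; split=> //.
by apply: contraTneq lxy => ->; rewrite ltnn.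
Qed.

Lemma polar_lineE N (l : {set F2vec N}) x y :
  l \in polar_lines N -> x \in l -> y \in l -> x != y ->
  l = [set x; y; x + y] /\ ~~ sympb x y.
Proof.
rewrite inE => /existsP[a /existsP[b /and5P[_ _ ab ab0 /eqP->]]].
have {}ab0 : sympb a b = false by rewrite /sympb ab0.
have aab : a + (a + b) = b by rewrite addrA addvv2 add0r.
have bab : b + (a + b) = a by rewrite addrCA addvv2 addr0.
(* Nine cases for [x] and [y] among [a], [b], [a + b]; two different ones sum to the third in
   characteristic 2. *)
rewrite !inE -!orbA => /or3P[] /eqP-> /or3P[] /eqP->; rewrite ?eqxx // => _;
  rewrite ?[a + b + _]addrC ?[b + a]addrC ?aab ?bab;
  rewrite ?(sympbDl, sympbDr) ?sympbxx ?[sympb b a]sympbC ab0; split=> //;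
  apply/setP=> z; rewrite !inE;
  by case: (z == a); case: (z == b); case: (z == a + b).
Qed.

(** * The doily spanned by five vectors with Gram matrix [doily_gram] *)

Section DoilyOf.

Variables (N : nat) (t : seq (F2vec N)).
Hypothesis t_gram : gram t = doily_gram.

Lemma size_doily_frame : size t = 5%N.
Proof. by rewrite -size_gram t_gram. Qed.

Lemma map_sympb_doily x : x \in doily_points ->
  map (sympb (ev t x)) t = doily_profile x.
Proof.
move=> /size_doily_points x5.
by rewrite sympb_ev_family ?size_doily_frame // t_gram.
Qed.

Lemma ev_doily_inj : {in doily_points &, injective (ev t)}.
Proof.
move=> x y xp yp xy; apply: doily_profile_inj => //.
by rewrite -!map_sympb_doily ?xy.
Qed.

Lemma ev_doily_neq0 x : x \in doily_points -> ev t x != 0.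
Proof.
move=> xp; apply/eqP=> x0; have := doily_profile_neq0 xp.
by rewrite -map_sympb_doily // x0 => /mapP[z _]; rewrite sympb0l.
Qed.

Lemma sympb_doily x y : x \in doily_points -> y \in doily_points ->
  sympb (ev t x) (ev t y) = alt_form doily_gram x y.
Proof.
move=> /size_doily_points x5 /size_doily_points y5.
by rewrite sympb_ev ?t_gram ?size_doily_frame.
Qed.

Lemma image_doily_line x y : size x = 5%N -> size y = 5%N ->
  [set:: map (ev t) [:: x; y; xorv x y]] = [set ev t x; ev t y; ev t x + ev t y].
Proof.
move=> x5 y5; apply/setP=> z.
by rewrite /= !inE ev_xorv ?size_doily_frame // orbA.
Qed.

Lemma is_doily_doily_of : is_doily (doily_of t).1 (doily_of t).2.
Proof.
apply/and4P; split; last 2 first.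
- exact: GQ22_image ev_doily_inj seq_GQ22_doily.
- apply/forall_inP=> a; rewrite [a \in _]inE => /mapP[x xp ->].
  apply/forall_inP=> b; rewrite [b \in _]inE => /mapP[y yp ->]; apply/implyP=> xy.
  rewrite (on_common_line_image ev_doily_inj seq_GQ22_doily) //.
  rewrite doily_collinear //; last by apply: contraNneq xy => ->.
  by rewrite -sympb_doily // negbK.
- apply/subsetP=> a; rewrite !in_set => /mapP[x xp ->].
  exact: ev_doily_neq0.
apply/subsetP=> l; rewrite [l \in image_lines _ _]inE.
case/mapP=> m /doily_linesP[x [y [xp yp xy xy0 ->]]] ->; rewrite inE.
apply/existsP; exists (ev t x); apply/existsP; exists (ev t y).
apply/and5P; split; rewrite ?ev_doily_neq0 //.
- by apply: contraNneq xy => /ev_doily_inj->.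
- by rewrite -sympb_doily // negbK in xy0.
by rewrite image_doily_line // size_doily_points.
Qed.

Lemma mem_doily_of_frame z : z \in t -> z \in (doily_of t).1.
Proof.
rewrite inE -{1}(map_ev_unit_bits t) size_doily_frame => /mapP[m mu ->].
(* The unit vectors are zeros of the quadratic form, hence points of the model. *)
by apply: map_f; apply: (allP _ _ mu); vm_compute.
Qed.

(** This turns the condition of spanning a PG(4, 2) into freeness of the five generators. *)
Lemma span_doily_of : <<enum (doily_of t).1>>%VS = <<t>>%VS.
Proof.
apply/eqP; rewrite eqEsubv; apply/andP; split; apply/span_subvP=> z.
  rewrite mem_enum inE => /mapP[m mp ->].
  by rewrite mem_span_ev map_f // size_doily_frame doily_points_sub.
by move/mem_doily_of_frame; rewrite -mem_enum; apply: memv_span.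
Qed.

Lemma card_doily_of : #|(doily_of t).1| = 15%N /\ #|(doily_of t).2| = 15%N.
Proof.
by have /and4P[_ _ /and5P[/eqP-> /eqP-> _ _ _] _] := is_doily_doily_of.
Qed.

End DoilyOf.

(** * Every doily is generated by five of its points *)

Definition join_orthogonal (s : seq bitseq) : seq bitseq :=
  undup (s ++ [seq xorv x y | x <- s,
    y <- [seq y <- s | (doily_profile x != doily_profile y)
                         && ~~ alt_form doily_gram x y]]).

Section Doily.

Variables (N : nat) (P : {set F2vec N}) (L : {set {set F2vec N}}).
Hypothesis PL_doily : is_doily P L.

Lemma doily_cards :
  [/\ #|P| = 15%N, #|L| = 15%N & forall l, l \in L -> l \subset P /\ #|l| = 3%N].
Proof.
case/and4P: PL_doily => _ _ /and5P[/eqP-> /eqP-> /forall_inP lP _ _] _.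
by split=> // l /lP/andP[? /eqP].
Qed.

Lemma doily_line_sub l : l \in L -> {subset l <= P}.
Proof. by case: doily_cards => _ _ lP /lP[/subsetP]. Qed.

Lemma doily_line_eq l x y : l \in L -> x \in l -> y \in l -> x != y ->
  l = [set x; y; x + y] /\ ~~ sympb x y.
Proof.
by case/and4P: PL_doily => _ /subsetP LP _ _ /LP; apply: polar_lineE.
Qed.

Lemma on_common_lineE x y : x \in P -> y \in P -> x != y ->
  on_common_line L x y = ~~ sympb x y.
Proof.
case/and4P: PL_doily => _ _ _ /forall_inP H xP yP xy.
by have /forall_inP/(_ y yP) := H x xP; rewrite xy negbK => /eqP->.
Qed.

Lemma doily_line x y : x \in P -> y \in P -> x != y -> ~~ sympb x y ->
  [set x; y; x + y] \in L.
Proof.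
move=> xP yP xy; rewrite -on_common_lineE // => /exists_inP[l lL /andP[xl yl]].
by have [<-] := doily_line_eq lL xl yl xy.
Qed.

Lemma doily_closed x y : x \in P -> y \in P -> x != y -> ~~ sympb x y ->
  x + y \in P.
Proof.
move=> xP yP xy xy0; apply: doily_line_sub (doily_line xP yP xy xy0) _ _.
by rewrite !inE eqxx !orbT.
Qed.

(** A doily contains the third point of the line through any two of its orthogonal points, hence
    every point generated from [t]; as both sides have 15 points and 15 lines, inclusions are
    equalities. *)
Lemma doily_generated t : gram t = doily_gram -> {subset t <= P} ->
  doily_of t = (P, L).
Proof.
move=> tG tP; have t5 := size_doily_frame tG.
pose good (s : seq bitseq) :=
  forall x : bitseq, x \in s -> size x = 5%N /\ ev t x \in P.
have step s : good s -> good (join_orthogonal s).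
  move=> sgood z; rewrite mem_undup mem_cat => /orP[/sgood//|].
  case/allpairsPdep=> x [y [/sgood[x5 xP]]]; rewrite mem_filter.
  case/andP=> /andP[xy xy0] /sgood[y5 yP] ->; rewrite size_xorv ?x5 //.
  split=> //; rewrite ev_xorv ?t5 //; apply: doily_closed => //.
    (* Different profiles give different vectors, so the third point is that of a genuine line. *)
    apply: contraNneq xy => exy.
    by rewrite /doily_profile -t5 -tG -!sympb_ev_family ?t5 ?exy.
  by rewrite sympb_ev ?tG ?t5.
have units : good (unit_bits 5).
  move=> x xu; split; first exact: size_unit_bits xu.
  by apply: tP; have := map_f (ev t) xu; rewrite -t5 map_ev_unit_bits.
have ptsP : {in doily_points, forall x, ev t x \in P}.
  (* Three rounds reach all 15 points: the first adds p + c_i and q + c_i, the second p + q + c_i +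
     c_j with i != j, the third p + q + c1 + c2 + c3. *)
  move=> x xp; have /allP/(_ x xp) : all
    [in iter 3 join_orthogonal (unit_bits 5)] doily_points by vm_compute.
  by move/(step _ (step _ (step _ units)))=> [].
have [cP cL] := card_doily_of tG; have [PE LE _] := doily_cards.
have eP : (doily_of t).1 = P.
  apply/eqP; rewrite eqEcard cP PE leqnn andbT.
  by apply/subsetP=> z; rewrite in_set => /mapP[x xp ->]; apply: ptsP.
rewrite [LHS]surjective_pairing eP; congr (_, _).
apply/eqP; rewrite eqEcard cL LE leqnn andbT; apply/subsetP=> l.
rewrite [l \in _]inE => /mapP[m /doily_linesP[x [y [xp yp xy xy0 ->]]] ->].
rewrite image_doily_line ?size_doily_points //.
apply: doily_line; rewrite ?ptsP ?sympb_doily //.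
by apply: contraNneq xy => /(ev_doily_inj tG)->.
Qed.

(* p and q are opposite points, and the c_i are the points of the three lines
   through p collinear with q. *)
Lemma doily_frame_exists : exists2 t : seq (F2vec N),
  gram t = doily_gram & {subset t <= P}.
Proof.
have [P15 L15 lineP] := doily_cards.
case/and4P: PL_doily => _ _ /and5P[_ _ _ /forall_inP deg /forall_inP GQ] _.
have [p pP] : exists p, p \in P by apply/card_gt0P; rewrite P15.
pose Lp := [set l in L | p \in l]; have Lp3 : #|Lp| = 3%N := eqP (deg p pP).
(* Three lines of three points cover at most 9 of the 15 points. *)
have [q qP qLp] : exists2 q, q \in P & q \notin cover Lp.
  apply/subsetPn; apply: contraTN isT => /subset_leq_card.
  rewrite P15 => cov; have := leq_trans cov (leq_card_cover Lp).
  rewrite (eq_bigr (fun=> 3%N)) ?sum_nat_const ?Lp3 // => l.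
  by rewrite inE => /andP[/lineP[]].
have LpP l : l \in Lp -> [/\ l \in L, p \in l & q \notin l].
  move=> lLp; move: (lLp); rewrite inE => /andP[lL pl]; split=> //.
  by apply: contraNN qLp => ql; apply/bigcupP; exists l.
have pqN l : l \in L -> ~~ ((p \in l) && (q \in l)).
  move=> lL; apply/negP=> /andP[pl].
  by apply/negP; have [] := LpP l; rewrite ?inE ?lL.
have pq : sympb p q.
  rewrite -[sympb p q]negbK -on_common_lineE //.
    by apply/exists_inP=> -[l lL]; apply/negP/pqN.
  have /card_gt0P[l /LpP[_ pl ql]] : (0 < #|Lp|)%N by rewrite Lp3.
  by apply: contraNneq ql => <-.
(* The quadrangle axiom for [q] and [l] gives the common neighbour of [p] and [q] on [l]. *)
have footP l : l \in Lp -> exists a,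
    [/\ a \in l, a \in P, p != a, ~~ sympb p a & ~~ sympb q a].
  move=> lLp; have [lL pl ql] := LpP l lLp.
  have /forall_inP/(_ q) := GQ l lL; rewrite inE ql qP => /(_ isT)/eqP card1.
  have /card_gt0P[a] : (0 < #|[set a in l | on_common_line L q a]|)%N.
    by rewrite card1.
  rewrite inE => /andP[al qa]; have aP := doily_line_sub lL al.
  have pa : p != a.
    apply: contraTneq qa => <-; apply/exists_inP=> -[m mL].
    by rewrite andbC; apply/negP/pqN.
  exists a; split=> //; first by have [] := doily_line_eq lL pl al pa.
  rewrite -on_common_lineE //; by apply: contraNneq ql => ->.
(* If [a] and [b] were orthogonal, [a] would be collinear with two points [p] and [b] of [m],
   against the quadrangle axiom. *)
have foot_sympb l m a b : l \in Lp -> m \in Lp -> l != m -> a \in l -> b \in m ->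
    p != a -> p != b -> sympb a b.
  move=> /LpP[lL pl _] /LpP[mL pm _] lm al bm pa pb; apply: contraT => ab0.
  have am : a \notin m.
    apply: contraNN lm => am.
    have [-> _] := doily_line_eq lL pl al pa.
    by have [-> _] := doily_line_eq mL pm am pa.
  have aP := doily_line_sub lL al; have bP := doily_line_sub mL bm.
  have ab : a != b by apply: contraNneq am => ->.
  have /forall_inP/(_ a) := GQ m mL; rewrite inE am aP => /(_ isT)/cards1P[c mE].
  have /set1P pc : p \in [set c].
    by rewrite -mE inE pm; apply/exists_inP; exists l; rewrite ?al.
  have /set1P bc : b \in [set c] by rewrite -mE inE bm on_common_lineE.
  by rewrite pc bc eqxx in pb.
have /card_gt0P[l1 l1p] : (0 < #|Lp|)%N by rewrite Lp3.
have /card_gt0P[l2 /setD1P[l21 l2p]] : (0 < #|Lp :\ l1|)%N.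
  by move: Lp3; rewrite (cardsD1 l1) l1p; case: #|_|.
have /card_gt0P[l3 /setD1P[l32 /setD1P[l31 l3p]]] : (0 < #|Lp :\ l1 :\ l2|)%N.
  by move: Lp3;
    rewrite (cardsD1 l1) l1p (cardsD1 l2) !in_setD1 l21 l2p;
    case: #|_|.
have [c1 [c1l c1P pc1 /negbTE pc1N /negbTE qc1N]] := footP l1 l1p.
have [c2 [c2l c2P pc2 /negbTE pc2N /negbTE qc2N]] := footP l2 l2p.
have [c3 [c3l c3P pc3 /negbTE pc3N /negbTE qc3N]] := footP l3 l3p.
exists [:: c3; c2; c1; q; p].
  rewrite /= (foot_sympb l3 l2 c3 c2) // (foot_sympb l3 l1 c3 c1) //.
  rewrite (foot_sympb l2 l1 c2 c1) //.
  rewrite !(sympbC _ q) !(sympbC _ p) ?[sympb q p]sympbC pq.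
  by rewrite pc1N pc2N pc3N qc1N qc2N qc3N.
by move=> x; rewrite !inE => /or4P[|||/orP[]] /eqP->.
Qed.

End Doily.

(* 720 = 15 * 8 * 3!, choosing p, q and an order on their common neighbours. *)
Lemma card_quadratic_doilies N :
  (#|quadratic_doilies N| * 720)%N = nb_frames N doily_gram.
Proof.
rewrite -card_frames //; symmetry.
apply: (@card_uniform_fibers _ _
  (fun t : (size doily_gram).-tuple (F2vec N) => doily_of t) _
  (quadratic_doilies N)) => [t|[P L]].
  rewrite !inE => /andP[tfree /eqP tG].
  by rewrite is_doily_doily_of // span_doily_of // (eqP tfree) size_tuple.
rewrite inE /= => /andP[PLd /eqP dP].
have [t tG tP] := doily_frame_exists PLd.
have tPL := doily_generated PLd tG tP.
have t5 := size_doily_frame tG.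
(* Five vectors spanning a 5-dimensional space are free. *)
have tfree : free t by rewrite /free -(span_doily_of tG) tPL dP t5.
have tcard := card_frames_in (t0 := t) (S := doily_points) doily_gram tfree.
transitivity (size (frames_in doily_gram doily_points doily_gram)).
  rewrite tG t5 in tcard; rewrite -tcard ?filter_uniq ?bits_uniq //; last first.
    exact: doily_points_sub.
  (* By [doily_generated], a frame yields this doily iff its entries lie in [P]. *)
  apply: eq_card => s; rewrite !inE; apply: andb_id2l => /andP[_ /eqP sG].
  apply/eqP/allP=> [sPL x /(mem_doily_of_frame sG)|sP].
    by rewrite sPL -tPL inE.
  apply: doily_generated => // x /sP xs.
  by have -> : P = (doily_of t).1; [rewrite tPL | rewrite inE].
by vm_compute.
Qed.

(** * Evaluation of the two counts *)

Lemma nb_frames_hyperbolic N : nb_frames N hyperbolic_gram =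
  ((2 ^ (N + N - 0) - 1) * (2 ^ (N + N - 1) - 2) * (2 ^ (N + N - 2) - 4)
   * (2 ^ (N + N - 3) - 0))%N.
Proof. by rewrite /= mul1n. Qed.

(** Factors for p, q, c1, c2, c3 in this order. The excluded solutions are 0 for p, none for q, 0
    for c1, none for c2, and c1 + c2 for c3. *)
Lemma nb_frames_doily N : nb_frames N doily_gram =
  ((2 ^ (N + N - 0) - 1) * (2 ^ (N + N - 1) - 0) * (2 ^ (N + N - 2) - 1)
   * (2 ^ (N + N - 3) - 0) * (2 ^ (N + N - 4) - 1))%N.
Proof. by rewrite /= mul1n. Qed.

(** With N = n + 3 every factor becomes a polynomial in (2 ^ n) ^ 2; the bound on [m] keeps the
    truncated subtraction exact. *)
Lemma natr_expB (R : pzRingType) n k m : (k <= 6)%N -> (m <= 2 ^ (6 - k))%N ->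
  (2 ^ (n.+3 + n.+3 - k) - m)%:R
    = 2 ^+ (6 - k) * (2 ^+ n) ^+ 2 - m%:R :> R.
Proof.
move=> k6 mle.
have -> : (n.+3 + n.+3 - k)%N = ((6 - k) + n * 2)%N by lia.
rewrite natrB ?natrX ?exprD ?exprM //.
by rewrite (leq_trans mle) // leq_pexp2l // leq_addr.
Qed.

(** The factors 2 ^ j - 1 and 2 ^ j + 1 pair up for j = N, N - 1, N - 2, and the constant is 7 / 3
    divided by 1 * 3 * 7. *)
Lemma Theta3E n : Theta3 n.+3 =
  (64 * (2 ^+ n) ^+ 2 - 1) * (16 * (2 ^+ n) ^+ 2 - 1)
  * (4 * (2 ^+ n) ^+ 2 - 1) * (2 ^+ n) ^+ 2 / 9.
Proof.
rewrite /Theta3 unlock /= !mulr1.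
have -> : (2 * n.+3 - 6)%N = (n * 2)%N by lia.
have -> : (n.+3 - 3 + 1)%N = n.+1 by lia.
have -> : (n.+3 - 3 + 2)%N = n.+2 by lia.
have -> : (n.+3 - 3 + 3)%N = n.+3 by lia.
have -> : (n.+3 + 1 - 1)%N = n.+3 by lia.
have -> : (n.+3 + 1 - 2)%N = n.+2 by lia.
have -> : (n.+3 + 1 - 3)%N = n.+1 by lia.
by rewrite exprM !exprS expr0; field.
Qed.

Theorem mainTheorem4 (N : nat) (hN : (3 <= N)%N) :
  (#|solids_with_3_isotropic_planes N|)%:R = Theta3 N
  /\ (#|quadratic_doilies N|)%:R = 48 / 15 * 4 ^+ (N - 3)%N * Theta3 N.
Proof.
case: N hN => [|[|[|n]]] // _.
have := congr1 (fun m => m%:R : rat) (card_quadratic_doilies n.+3).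
have := congr1 (fun m => m%:R : rat) (card_solids_with_3_isotropic_planes n.+3).
rewrite nb_frames_hyperbolic nb_frames_doily !natrM !natr_expB // Theta3E.
have -> : 4 ^+ (n.+3 - 3) = (2 ^+ n) ^+ 2 :> rat.
  by rewrite -exprM mulnC exprM !subSS subn0.
set y := 2 ^+ n; set s := (#|solids_with_3_isotropic_planes _|)%:R => sE.
set d := (#|quadratic_doilies _|)%:R => dE; split.
  by apply: (@mulIf _ 576%:R); rewrite ?pnatr_eq0 // sE; field.
by apply: (@mulIf _ 720%:R); rewrite ?pnatr_eq0 // dE; field.
Qed.
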